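(* Let $\alpha>0$, $L>0$, and let $\mathcal{H}$ be an infinite dimensional Hilbert space with fixed orthonormal basis $\{|e_j\rangle\}_{j\ge0}$. Let $\rho_0=|\psi_0\rangle\langle\psi_0|$ be a fixed pure state in the interior of $S^\alpha(L)$, i.e. $\rho_0\in S^\alpha(L')$ for some $L'<L$. In the i.i.d. quantum model $\mathcal{Q}_n=\{\rho^{\otimes n}:\rho\in S^\alpha(L)\}$ consider the testing problem $$H_0:\ \rho=\rho_0,\qquad H_1(\varphi_n):\ \rho\in S^\alpha(L)\cap B(\varphi_n),$$ where $B(\varphi)=\{\rho \text{ pure}:\ \|\rho-\rho_0\|_1\ge\varphi\}$ and $\{\varphi_n\}_{n\ge1}$ is a decreasing sequence of positive real numbers. Then $\varphi_n^*=n^{-1/2}$ is a minimax separation rate, that is, for every such sequence $\{\varphi_n\}$, $$\mathbb{P}_e^*(\varphi_n)\to1\ \text{ if }\ \varphi_n/\varphi_n^*\to0,\qquad\text{and}\qquad \mathbb{P}_e^*(\varphi_n)\to0\ \text{ if }\ \varphi_n/\varphi_n^*\to\infty.$$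
   Context: The Hermite-Sobolev class is $S^\alpha(L)=\{|\psi\rangle\langle\psi|:\ \sum_{j=0}^\infty|\psi_j|^2j^{2\alpha}\le L,\ \|\psi\|=1\}$, where $\psi_j=\langle e_j|\psi\rangle$. The trace norm is $\|\tau\|_1=\mathrm{Tr}(|\tau|)$, $|\tau|=(\tau^*\tau)^{1/2}$. A binary POVM on $\mathcal{H}^{\otimes n}$ is a pair $M=(M_0,M_1)$ of positive bounded operators with $M_0+M_1=\mathbf 1$ ($M_1$ corresponds to rejecting $H_0$). The worst case total error probability of $M$ is $$\mathbb{P}_e^M(\varphi_n)=\mathrm{Tr}(\rho_0^{\otimes n}M_1)+\sup_{\rho\in S^\alpha(L)\cap B(\varphi_n)}\mathrm{Tr}(\rho^{\otimes n}M_0),$$ and the minimax total error probability is $\mathbb{P}_e^*(\varphi_n)=\inf_M\mathbb{P}_e^M(\varphi_n)$, the infimum being over all binary POVMs $M$ on $\mathcal{H}^{\otimes n}$. *)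

(* Defs.v *)
From HB Require Import structures.
From mathcomp Require Import all_boot all_order all_algebra.
From mathcomp Require Import sesquilinear finmap complex.
From mathcomp Require Import all_classical all_reals.
From mathcomp Require Import ereal topology normedtype sequences exp.
From mathcomp.analysis.showcase Require summability.

Set Implicit Arguments.
Unset Strict Implicit.
Unset Printing Implicit Defensive.

Import Order.TTheory GRing.Theory Num.Theory.
Import numFieldNormedType.Exports.

Local Open Scope classical_set_scope.
Local Open Scope complex_scope.
Local Open Scope ring_scope.

(* [hdot] is linear in its first argument; see [braket] for the bra-ket
   convention. *)
HB.mixin Record isHilbert (R : realType) H of CompleteNormedModule R[i] H := {
  hdot : {dot H for (@Num.conj R[i])};
  hdotE : forall x : H, `|x| ^+ 2 = hdot x x
}.

#[short(type="hilbertType")]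
HB.structure Definition Hilbert (R : realType) :=
  {H of isHilbert R H & CompleteNormedModule R[i] H}.

(* <x|y>, conjugate-linear in x and linear in y. *)
Definition braket (R : realType) (H : hilbertType R) (x y : H) : R[i] :=
  hdot y x.

Section Operators.
Context {R : realType} {H : hilbertType R}.
Implicit Types (A : set H) (x y psi : H) (S T rho tau : H -> H).

Definition lin_span A : set H :=
  [set x | exists (n : nat) (c : 'I_n -> R[i]) (a : 'I_n -> H),
     (forall k, A (a k)) /\ x = \sum_(k < n) c k *: a k].

Definition total_set A := closure (lin_span A) = setT.

Definition orthonormal_basis (I : eqType) (b : I -> H) :=
  (forall i j, braket (b i) (b j) = (i == j)%:R) /\ total_set (range b).

(* Operators are plain functions; linearity is part of boundedness. *)
Definition bounded_op T :=
  linear T /\ exists M : R[i], forall x, `|T x| <= M * `|x|.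

(* In the order of R[i], 0 <= z says that z is real and nonnegative. *)
Definition positive_op T := forall x, 0 <= braket x (T x).

Definition adjoint_op T : H -> H :=
  xget (fun=> 0) [set S | forall x y, braket (S x) y = braket x (T y)].

(* |T| = (T^* T)^(1/2): the positive bounded square root of T^* T. *)
Definition abs_op T : H -> H :=
  xget (fun=> 0) [set S | [/\ bounded_op S, positive_op S
                            & S \o S = adjoint_op T \o T]].

(* The sum is the limit of the net of finite partial sums; for a trace-class T
   it does not depend on the orthonormal basis b. *)
Definition trace (I : choiceType) (b : I -> H) T : R[i] :=
  summability.sum (fun i => braket (b i) (T (b i)) : R[i]^o).

Definition trace_norm (I : choiceType) (b : I -> H) T : R :=
  complex.Re (trace b (abs_op T)).

Definition ketbra psi : H -> H := fun x => braket psi x *: psi.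

Definition pure_state rho := exists2 psi, `|psi| = 1 & rho = ketbra psi.

End Operators.

(* The n-th Hilbert space tensor power of H, which is unique up to unitary
   equivalence: a Hilbert space with an n-linear map
   (x_1, ..., x_n) |-> x_1 (x) ... (x) x_n whose range is total and such that
   <x_1 (x) ... (x) x_n | y_1 (x) ... (x) y_n> = <x_1|y_1> ... <x_n|y_n>. *)
Record tensor_power (R : realType) (H : hilbertType R) (n : nat) := {
  tensor_space :> hilbertType R;
  tens : ('I_n -> H) -> tensor_space;
  tens_multilinear : forall (x : 'I_n -> H) (i : 'I_n) (a : R[i]) (u v : H),
    tens (dfwith x i (a *: u + v)) =
      a *: tens (dfwith x i u) + tens (dfwith x i v);
  tens_braket : forall x y : 'I_n -> H,
    braket (tens x) (tens y) = \prod_(k < n) braket (x k) (y k);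
  tens_total : total_set (range tens)
}.

Arguments tens {R H n} t x.

Section TensorPower.
Context {R : realType} {H : hilbertType R} {n : nat} (K : tensor_power H n).

Definition tens_basis (b : nat -> H) (j : {ffun 'I_n -> nat}) : K :=
  tens K (fun k => b (j k)).

(* The bounded operator T (x) ... (x) T, determined by its values on the
   elementary tensors. *)
Definition op_tens (T : H -> H) : K -> K :=
  xget (fun=> 0) [set S | bounded_op S /\
    forall x : 'I_n -> H, S (tens K x) = tens K (fun k => T (x k))].

End TensorPower.

Arguments tens_basis {R H n} K b j.
Arguments op_tens {R H n} K T.

Section Testing.
Context {R : realType} {H : hilbertType R}.
Variable e : nat -> H.

Definition hermite_sobolev (alpha L : R) : set (H -> H) :=
  [set rho | exists psi, [/\ rho = ketbra psi, `|psi| = 1 &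
     (\sum_(0 <= j <oo)
        (complex.Re `|braket (e j) psi| ^+ 2 * j%:R `^ (2 * alpha))%:E
        <= L%:E)%E]].

Definition trace_separated (rho0 : H -> H) (phi : R) : set (H -> H) :=
  [set rho | pure_state rho /\ phi <= trace_norm e (rho \- rho0)].

Record binary_povm (K : hilbertType R) := {
  povm0 : K -> K;
  povm1 : K -> K;
  povm0_bounded : bounded_op povm0;
  povm1_bounded : bounded_op povm1;
  povm0_positive : positive_op povm0;
  povm1_positive : positive_op povm1;
  povm_complete : povm0 \+ povm1 = id
}.

(* The traces of products of a state and a POVM element are real numbers. *)
Definition outcome_prob n (K : tensor_power H n) (rho : H -> H) (M : K -> K) : R :=
  complex.Re (trace (tens_basis K e) (op_tens K rho \o M)).

(* The supremum of the empty set is 0, as it should be for probabilities. *)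
Definition worst_error n (K : tensor_power H n) (alpha L : R) (rho0 : H -> H)
    (phi : R) (M : binary_povm K) : R :=
  outcome_prob rho0 (povm1 M) +
  sup [set outcome_prob rho (povm0 M) | rho in
         hermite_sobolev alpha L `&` trace_separated rho0 phi].

Definition minimax_error n (K : tensor_power H n) (alpha L : R) (rho0 : H -> H)
    (phi : R) : R :=
  inf (range (@worst_error n K alpha L rho0 phi)).

End Testing.

(* [Pe n phi] is the minimax error for sample size n and separation phi; the
   sequences are indexed by n >= 1. *)
Definition minimax_separation_rate (R : realType) (Pe : nat -> R -> R)
    (phistar : nat -> R) :=
  forall phi : nat -> R,
    (forall n, (0 < n)%N -> 0 < phi n) ->
    (forall m n, (0 < m)%N -> (m <= n)%N -> phi n <= phi m) ->
    ((phi n / phistar n @[n --> \oo] --> (0 : R)) ->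
       Pe n (phi n) @[n --> \oo] --> (1 : R)) /\
    ((phi n / phistar n @[n --> \oo] --> +oo) ->
       Pe n (phi n) @[n --> \oo] --> (0 : R)).

(* Main.v *)
(* Let Psi and Psi0 be the n-fold tensor powers of the unit vectors psi and psi0.
   For pure states, [trace_norm (rho - rho0) = 2 sqrt (1 - |<psi0|psi>|^2)] and
   [<Psi0|Psi> = <psi0|psi>^n].
   If [n phi_n^2] tends to infinity, the test accepting H_0 with the operator
   [|Psi0><Psi0|] never rejects rho0, and it accepts rho with probability
   [|<psi0|psi>|^(2n) <= (1 - phi_n^2 / 4)^n], which tends to 0.
   If [n phi_n^2] tends to 0, take [psi = sqrt (1 - s^2) psi0 + s v] with
   [s = phi_n / 2] and v a unit vector in the span of e_0 and e_1 orthogonal to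
   psi0. It lies in the Sobolev ball because rho0 is interior, and
   [|Psi - Psi0|^2 = 2 - 2 (1 - s^2)^(n/2)] tends to 0, so that no test separates
   Psi from Psi0. *)
Require Import Defs.
From mathcomp Require Import all_boot all_order all_algebra.
From mathcomp Require Import sesquilinear finmap complex.
From mathcomp Require Import all_classical all_reals.
From mathcomp Require Import ereal topology normedtype sequences exp.
From mathcomp.analysis.showcase Require summability.
From mathcomp Require Import ring lra.

Import Order.TTheory GRing.Theory Num.Theory.
Import numFieldNormedType.Exports.

Set Implicit Arguments.
Unset Strict Implicit.
Unset Printing Implicit Defensive.

Local Open Scope classical_set_scope.
Local Open Scope ring_scope.

#[local] Existing Instance summability.totally_filter.

(** * Bra-kets *)

Section Braket.
Context {R : realType} {H : hilbertType R}.
Implicit Types (x y z : H) (a : R[i]).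

Lemma braketDr x y z : braket x (y + z) = braket x y + braket x z.
Proof. by rewrite /braket linearDl. Qed.

Lemma braketZr x a y : braket x (a *: y) = a * braket x y.
Proof. by rewrite /braket linearZl_LR. Qed.

Lemma braketDl x y z : braket (x + y) z = braket x z + braket y z.
Proof. by rewrite /braket linearDr. Qed.

Lemma braketZl a x y : braket (a *: x) y = a^* * braket x y.
Proof. by rewrite /braket linearZr_LR. Qed.

Lemma conj_braket x y : (braket x y)^* = braket y x.
Proof. by rewrite /braket (hermC (@hdot R H) x y) expr0 mul1r. Qed.

Lemma braketNr x y : braket x (- y) = - braket x y.
Proof. by rewrite -scaleN1r braketZr mulN1r. Qed.

Lemma braketNl x y : braket (- x) y = - braket x y.
Proof. by rewrite -scaleN1r braketZl rmorphN1 mulN1r. Qed.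

Lemma braketBr x y z : braket x (y - z) = braket x y - braket x z.
Proof. by rewrite braketDr braketNr. Qed.

Lemma braketBl x y z : braket (x - y) z = braket x z - braket y z.
Proof. by rewrite braketDl braketNl. Qed.

Lemma braket0r x : braket x 0 = 0.
Proof. by rewrite -(scale0r (0 : H)) braketZr mul0r. Qed.

Lemma braket0l x : braket 0 x = 0.
Proof. by rewrite -conj_braket braket0r rmorph0. Qed.

Lemma braket_sumr x (I : Type) (s : seq I) (P : pred I) (f : I -> H) :
  braket x (\sum_(i <- s | P i) f i) = \sum_(i <- s | P i) braket x (f i).
Proof. exact: (big_morph _ (braketDr x) (braket0r x)). Qed.

Lemma braketxx x : braket x x = `|x| ^+ 2.
Proof. by rewrite hdotE. Qed.

Lemma braketxx_ge0 x : 0 <= braket x x.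
Proof. by rewrite braketxx exprn_ge0. Qed.

Lemma braketxx_eq0 x : braket x x = 0 -> x = 0.
Proof. by rewrite braketxx => /eqP; rewrite sqrf_eq0 normr_eq0 => /eqP. Qed.

Lemma braket_inj x y : (forall z, braket z x = braket z y) -> x = y.
Proof.
move=> xy; apply/eqP; rewrite -subr_eq0; apply/eqP/braketxx_eq0.
by rewrite braketBr xy subrr.
Qed.

Lemma braketl_inj x y : (forall z, braket x z = braket y z) -> x = y.
Proof.
by move=> xy; apply: braket_inj => z; rewrite -conj_braket xy conj_braket.
Qed.

(* The bound is [0 <= `|u y - v x| ^+ 2] for [u = `|x| ^+ 2], [v = <x|y>]. *)
Lemma CauchySchwarz x y : `|braket x y| <= `|x| * `|y|.
Proof.
have [->|x0] := eqVneq x 0; first by rewrite braket0l !normr0 mul0r.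
have xgt0 : 0 < `|x| ^+ 2 by rewrite exprn_gt0 ?normr_gt0.
rewrite -(@ler_pXn2r _ 2) ?nnegrE ?mulr_ge0// -(ler_pM2l xgt0).
rewrite -subr_ge0 (_ : _ - _ = braket (`|x| ^+ 2 *: y - braket x y *: x)
  (`|x| ^+ 2 *: y - braket x y *: x)) ?braketxx_ge0//.
rewrite !(braketBr, braketBl, braketZr, braketZl) conj_braket.
rewrite -(conj_braket x y) !braketxx normCK.
rewrite (geC0_conj (exprn_ge0 _ (normr_ge0 x))).
by ring.
Qed.

End Braket.

(** * Operators *)

Section Operators.
Context {R : realType} {H : hilbertType R}.
Implicit Types (x y z u v w psi : H) (a : R[i]) (S T : H -> H).

Lemma linear_opD T : linear T -> {morph T : x y / x + y}.
Proof. by move=> linT x y; have := linT 1 x y; rewrite !scale1r. Qed.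

Lemma linear_op0 T : linear T -> T 0 = 0.
Proof.
by move=> linT; apply: (@addrI _ (T 0)); rewrite -linear_opD// !addr0.
Qed.

Lemma linear_opZ T : linear T -> forall a, {morph T : x / a *: x}.
Proof.
by move=> linT a x; have := linT a x 0; rewrite !addr0 linear_op0 // addr0.
Qed.

Lemma linear_opB T : linear T -> {morph T : x y / x - y}.
Proof.
by move=> linT x y; rewrite -scaleN1r addrC linT scaleN1r addrC.
Qed.

(* Polarization with the vectors [x + y] and [x + 'i y]. *)
Lemma positive_op_sym T : linear T -> positive_op T ->
  forall x y, braket (T x) y = braket x (T y).
Proof.
move=> linT posT x y; rewrite -(conj_braket y).
have realq z : (braket z (T z))^* = braket z (T z) by apply/geC0_conj/posT.
have := realq (x + y); have := realq (x + 'i *: y).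
rewrite !(linear_opD linT) (linear_opZ linT).
rewrite !(braketDl, braketDr, braketZl, braketZr).
rewrite !(rmorphD, rmorphM) /= !conjCK conjCi !realq.
set b := braket y (T x); set a := braket x (T y) => h2 h1.
set c := braket x (T x) in h1 h2; set d := braket y (T y) in h1 h2.
have {}h1 : a^* + b^* = a + b.
  by apply: (@addrI _ (c + d)); transitivity (c + a^* + (b^* + d));
    [ring|rewrite h1; ring].
have {}h2 : b^* - a^* = a - b.
  apply: (mulfI (neq0Ci R[i])); apply: (@addrI _ (c - 'i * ('i * d))).
  by transitivity (c + - 'i * a^* + ('i * b^* + - 'i * ('i * d)));
    [ring|rewrite h2; ring].
apply: (@mulfI R[i] 2); first by rewrite pnatr_eq0.
transitivity (a^* + b^* + (b^* - a^*)); first by ring.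
by rewrite h1 h2; ring.
Qed.

(* Evaluate the form at [(<Ty|T(Ty)> + 1) y - <y|T(Ty)> Ty]. *)
Lemma positive_op_ker T y : linear T -> positive_op T ->
  braket y (T y) = 0 -> T y = 0.
Proof.
move=> linT posT qy0; apply: braketxx_eq0.
have symT := positive_op_sym linT posT.
set c := braket (T y) (T y).
have c_ge0 : 0 <= c by exact: braketxx_ge0.
have q_ge0 := posT (T y); set q := braket (T y) _ in q_ge0.
have := posT ((q + 1) *: y - c *: T y) => h.
rewrite (linear_opB linT) !(linear_opZ linT) in h.
rewrite !(braketBl, braketBr, braketZl, braketZr) qy0 -(symT y) -/c -/q in h.
have q1 : (q + 1)^* = q + 1 by rewrite geC0_conj// addr_ge0.
rewrite (geC0_conj c_ge0) q1 in h.
have {}h : 0 <= - (c ^+ 2 * (q + 2)).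
  by apply: le_trans h _; rewrite le_eqVlt; apply/orP; left; apply/eqP; ring.
have : c ^+ 2 * (q + 2) = 0.
  by apply/le_anti; rewrite -oppr_ge0 h mulr_ge0 ?exprn_ge0 ?addr_ge0.
move=> /eqP; rewrite mulf_eq0 sqrf_eq0 => /orP[/eqP//|/eqP q2].
by have := ltr_wpDl q_ge0 (@ltr0n R[i] 2); rewrite q2 ltxx.
Qed.

(* If [y = S1 x - S2 x] then [S1 y + S2 y = S1^2 x - S2^2 x = 0]. *)
Lemma positive_sqrt_unique S1 S2 : linear S1 -> linear S2 ->
  positive_op S1 -> positive_op S2 ->
  (forall x, S1 (S2 x) = S2 (S1 x)) -> (forall x, S1 (S1 x) = S2 (S2 x)) ->
  S1 = S2.
Proof.
move=> lin1 lin2 pos1 pos2 S12 sqS; apply/funext => x.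
apply/eqP; rewrite -subr_eq0; apply/eqP; set y := S1 x - S2 x.
have : braket y (S1 y + S2 y) = 0.
  rewrite /y (linear_opB lin1) (linear_opB lin2) sqS S12.
  by rewrite addrA subrK subrr braket0r.
rewrite braketDr => /eqP; rewrite paddr_eq0 ?pos1 ?pos2// => /andP[/eqP q1 /eqP q2].
apply: braketxx_eq0; rewrite {1}/y braketBl.
rewrite (positive_op_sym lin1 pos1) (positive_op_sym lin2 pos2).
by rewrite (positive_op_ker lin1 pos1 q1) (positive_op_ker lin2 pos2 q2) !braket0r subrr.
Qed.

Lemma linear_ketbra psi : linear (ketbra psi).
Proof.
by move=> a x y; rewrite /ketbra braketDr braketZr scalerDl scalerA.
Qed.

Lemma bounded_ketbra psi : bounded_op (ketbra psi).
Proof.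
split; first exact: linear_ketbra.
exists (`|psi| ^+ 2) => x; rewrite normrZ expr2 mulrAC.
by rewrite ler_wpM2r ?CauchySchwarz.
Qed.

Lemma bounded_opB S T : bounded_op S -> bounded_op T -> bounded_op (S \- T).
Proof.
move=> [linS [M SM]] [linT [N TN]]; split=> [a x y|] /=.
  by rewrite linS linT scalerBr addrACA opprD.
exists (M + N) => x /=; rewrite mulrDl (le_trans (ler_normB _ _))// lerD//.
Qed.

(** The constant in [bounded_op] may be any complex number. As [M * |x|] dominates a norm, it equals
    its own modulus, so [|M|] serves instead of [M]. *)
Lemma bounded_op_bound T : bounded_op T ->
  exists2 M : R[i], 0 <= M & forall x, `|T x| <= M * `|x|.
Proof.
move=> [_ [M TM]]; exists `|M| => // x.
rewrite -[X in _ * X]normr_id -normrM ger0_norm//.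
exact: le_trans (normr_ge0 _) (TM x).
Qed.

Lemma bounded_op_scale_comp S T a :
  bounded_op S -> bounded_op T -> bounded_op (fun x => a *: S (T x)).
Proof.
move=> bS bT; have [M M_ge0 SM] := bounded_op_bound bS.
have [N N_ge0 TN] := bounded_op_bound bT; split=> [b x y|].
  by rewrite bT.1 bS.1 scalerDr !scalerA mulrC.
exists (`|a| * (M * N)) => x; rewrite normrZ -!mulrA ler_wpM2l//.
by rewrite (le_trans (SM _))// ler_wpM2l.
Qed.

Lemma ketbra_sym psi x y : braket (ketbra psi x) y = braket x (ketbra psi y).
Proof. by rewrite braketZl braketZr conj_braket mulrC. Qed.

(** The choice made by [adjoint_op] has a single candidate, since a vector is determined by its
    brackets with all vectors. *)
Lemma adjoint_op_sym T :
  (forall x y, braket (T x) y = braket x (T y)) -> adjoint_op T = T.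
Proof.
move=> symT; apply: xget_unique => [//|S adjS].
by apply/funext => x; apply: braketl_inj => y; rewrite adjS symT.
Qed.

End Operators.

(** * Total sets *)

Section TotalSets.
Context {R : realType} {H : hilbertType R}.
Implicit Types (x y z u v w psi : H) (a : R[i]) (S T : H -> H) (A : set H).

Lemma closure_approxP A x : closure A x <->
  forall eps : R[i], 0 < eps -> exists2 z, A z & `|x - z| < eps.
Proof.
split=> [clA eps eps_gt0|h B].
  have [z [Az]] := clA _ (nbhsx_ballx x _ eps_gt0).
  by rewrite -ball_normE => ?; exists z.
rewrite -nbhs_ballE => -[eps eps_gt0 sub].
have [z Az xz] := h _ eps_gt0; exists z; split=> //.
by apply: sub; rewrite -ball_normE.
Qed.

Lemma lin_span_ind A (P : H -> Prop) : P 0 ->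
  (forall a x y, P x -> P y -> P (a *: x + y)) ->
  (forall x, A x -> P x) -> forall x, lin_span A x -> P x.
Proof.
move=> P0 PD PA x [n [c [a [Aa ->]]]].
elim/big_ind: _ => // [y z Py Pz|k _]; first by rewrite -(scale1r y); exact: PD.
by rewrite -(addr0 (_ *: _)); apply: PD => //; exact: PA.
Qed.

(** A closed subspace containing a total set is the whole space. Later density arguments check that
    the property at hand defines such a subspace. *)
Lemma total_set_ind A (P : H -> Prop) : total_set A -> P 0 ->
  (forall a x y, P x -> P y -> P (a *: x + y)) ->
  (forall x, closure P x -> P x) ->
  (forall x, A x -> P x) -> forall x, P x.
Proof.
move=> totA P0 PD Pcl PA x; apply: Pcl; have : setT x by [].
rewrite -totA; apply: closure_subset; exact: lin_span_ind.
Qed.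

Lemma lin_span_self A x : A x -> lin_span A x.
Proof.
move=> Ax; exists 1, (fun=> 1), (fun=> x); split=> //.
by rewrite big_ord1 scale1r.
Qed.

Lemma lin_span0 A : lin_span A 0.
Proof.
exists 0, (fun=> 0), (fun=> 0); split=> [[]//|].
by rewrite big_ord0.
Qed.

Lemma lin_span_linear A a x y :
  lin_span A x -> lin_span A y -> lin_span A (a *: x + y).
Proof.
move=> [m [c [u [Au ->]]]] [n [d [v [Av ->]]]].
exists (m + n)%N,
  (fun k => match fintype.split k with inl i => a * c i | inr j => d j end),
  (fun k => match fintype.split k with inl i => u i | inr j => v j end); split.
  by move=> k; case: fintype.split.
rewrite big_split_ord scaler_sumr /=; congr (_ + _); apply: eq_bigr => i _.
  by rewrite (unsplitK (inl i)) scalerA.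
by rewrite (unsplitK (inr i)).
Qed.

Lemma closure_lin_span_linear A a x y : closure (lin_span A) x ->
  closure (lin_span A) y -> closure (lin_span A) (a *: x + y).
Proof.
move=> /closure_approxP Ax /closure_approxP Ay; apply/closure_approxP => eps eps_gt0.
(* Adding [1] keeps the divisor nonzero when [a = 0]. *)
have a1_gt0 : 0 < `|a| + 1 by rewrite ltr_wpDl.
have [u Au xu] := Ax (eps / 2 / (`|a| + 1))
  (divr_gt0 (divr_gt0 eps_gt0 (ltr0Sn _ _)) a1_gt0).
have [v Av yv] := Ay (eps / 2) (divr_gt0 eps_gt0 (ltr0Sn _ _)).
exists (a *: u + v); first exact: lin_span_linear.
rewrite opprD addrACA -scalerBr (le_lt_trans (ler_normD _ _))//.
rewrite [ltRHS](splitr eps) ler_ltD// normrZ.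
move/ltW: xu; rewrite ler_pdivlMr// mulrC; apply: le_trans.
by rewrite ler_wpM2r// lerDl.
Qed.

Lemma total_setP A : (forall x, closure (lin_span A) x) -> total_set A.
Proof. by move=> h; apply/seteqP; split. Qed.

(** The vectors at which two bounded operators agree form a closed subspace. This makes a bounded
    operator prescribed on elementary tensors unique. *)
Lemma bounded_op_eq_total A S T : total_set A -> bounded_op S -> bounded_op T ->
  (forall x, A x -> S x = T x) -> S = T.
Proof.
move=> totA bS bT ST; apply/funext; apply: (total_set_ind totA) => //.
- by rewrite (linear_op0 bS.1) (linear_op0 bT.1).
- by move=> a x y Sx Sy; rewrite bS.1 bT.1 Sx Sy.
move=> x /closure_approxP clx; apply/eqP; rewrite -subr_eq0 -normr_eq0.
have [M M_ge0 DM] := bounded_op_bound (bounded_opB bS bT).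
rewrite eq_le normr_ge0 andbT; apply/ler_addgt0Pr => eps eps_gt0.
rewrite add0r.
have M1_gt0 : 0 < M + 1 by rewrite ltr_wpDl.
have [z Tz xz] := clx (eps / (M + 1)) (divr_gt0 eps_gt0 M1_gt0).
rewrite (_ : S x - T x = (S \- T) (x - z)).
  rewrite (le_trans (DM _))//; move/ltW: xz; rewrite ler_pdivlMr// mulrC.
  by apply: le_trans; rewrite ler_wpM2r// lerDl.
by rewrite /= (linear_opB bS.1) (linear_opB bT.1) Tz opprB addrA subrK.
Qed.

End TotalSets.

(** * Expansion in an orthonormal basis *)

Section Parseval.
Context {R : realType} {H : hilbertType R} {I : choiceType} (b : I -> H).
Hypothesis hb : orthonormal_basis b.
Implicit Types (x y u v : H) (A : {fset I}) (i : I).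

(** The orthogonal projection of [y] onto the span of the [b i] with [i] in [A]. *)
Let proj y A : H := summability.partial_sum (fun i => braket (b i) y *: b i) A.

Let projE y A : proj y A = \sum_(i <- A) braket (b i) y *: b i.
Proof.
by rewrite /proj /summability.partial_sum
  -(big_seq_fsetE _ A xpredT (fun i => braket (b i) y *: b i)).
Qed.

Let proj_linear A : linear (proj ^~ A).
Proof.
move=> a x y; rewrite !projE scaler_sumr -big_split /=.
by apply: eq_bigr => i _; rewrite braketDr braketZr scalerDl scalerA.
Qed.

Let braket_proj y A i : i \in A -> braket (b i) (proj y A) = braket (b i) y.
Proof.
move=> iA; rewrite projE braket_sumr (big_fsetD1 i)//= braketZr hb.1 eqxx mulr1.
rewrite big_seq_cond big1 ?addr0// => j /andP[]; rewrite !inE => /andP[ji _] _.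
by rewrite braketZr hb.1 eq_sym (negbTE ji) mulr0.
Qed.

Let proj_basis A i : i \in A -> proj (b i) A = b i.
Proof.
move=> iA; rewrite projE (big_fsetD1 i)//= hb.1 eqxx scale1r.
rewrite big_seq_cond big1 ?addr0// => j /andP[]; rewrite !inE => /andP[ji _] _.
by rewrite hb.1 (negbTE ji) scale0r.
Qed.

Let bessel y A : `|y - proj y A| <= `|y|.
Proof.
rewrite -(@ler_pXn2r _ 2) ?nnegrE// -!braketxx.
(* The projection is orthogonal to the remainder, so passing to the remainder lowers the squared
   norm by the sum of the [|<b i|y>|^2]. *)
have pp : braket (proj y A) (proj y A) = braket (proj y A) y.
  rewrite -(conj_braket (proj y A)) -[RHS]conj_braket; congr (_ ^*).
  rewrite [X in braket _ X]projE [X in _ = braket _ X]projE !braket_sumr.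
  rewrite big_seq_cond [RHS]big_seq_cond.
  apply: eq_bigr => i /andP[iA _]; rewrite !braketZr -(conj_braket (b i)).
  by rewrite braket_proj// conj_braket.
rewrite !(braketBl, braketBr) pp subrr subr0.
rewrite lerBlDr lerDl projE braket_sumr sumr_ge0// => i _.
by rewrite braketZr -(conj_braket (b i) y) -normCK exprn_ge0.
Qed.

(** The vectors at which the net converges form a closed subspace; closedness comes from [bessel],
    which is uniform in [A]. At [b i] the net is constant once [A] contains [i]. *)
Let proj_cvg y : proj y @ summability.totally --> y.
Proof.
move: y; apply: (total_set_ind hb.2) => [|a x y px py|x /closure_approxP clx|_ [i _ <-]].
- rewrite (_ : proj 0 = fun=> 0); first exact: cvg_cst.
  by apply/funext => A; rewrite projE big1// => i _; rewrite braket0r scale0r.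
- rewrite (_ : proj _ = (fun A => a *: proj x A + proj y A)).
    by apply: cvgD => //; apply: cvgZ => //; exact: cvg_cst.
  by apply/funext => A; rewrite proj_linear.
- apply/cvgrPdist_lt => eps eps_gt0.
  have e2 : 0 < eps / 2 by rewrite divr_gt0.
  have [z /cvgrPdist_lt/(_ _ e2) pz xz] := clx _ e2.
  apply: filterS pz => A zA.
  rewrite (_ : x - proj x A = (x - z - proj (x - z) A) + (z - proj z A)).
    rewrite (le_lt_trans (ler_normD _ _))// [ltRHS](splitr eps) ltrD//.
    exact: le_lt_trans (bessel _ _) xz.
  rewrite (linear_opB (proj_linear A)); by rewrite opprB addrACA subrK addrAC subrr add0r.
- apply: cvg_near_cst; exists [fset i]%fset => // A /= iA.
  by apply/proj_basis/(fsubsetP iA); rewrite inE.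
Qed.

(** The terms are the diagonal entries of the operator [x -> <v|x> u]. Their partial sums are
    [<v|proj u A>], and [<v|.>] is continuous by Cauchy-Schwarz. *)
Lemma braket_expansion u v :
  summability.partial_sum (fun i => braket (b i) (braket v (b i) *: u) : R[i]^o)
    @ summability.totally --> (braket v u : R[i]^o).
Proof.
rewrite (_ : summability.partial_sum _ = fun A => braket v (proj u A)).
  apply/cvgrPdist_lt => eps eps_gt0.
  have v1_gt0 : 0 < `|v| + 1 by rewrite ltr_wpDl.
  have /cvgrPdist_lt/(_ _ (divr_gt0 eps_gt0 v1_gt0)) := @proj_cvg u.
  apply: filterS => A uA; rewrite -braketBr (le_lt_trans (CauchySchwarz _ _))//.
  move: uA; rewrite ltr_pdivlMr// mulrC; apply: le_lt_trans.
  by rewrite ler_wpM2r// lerDl.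
apply/funext => A; rewrite projE braket_sumr /summability.partial_sum.
rewrite -(big_seq_fsetE _ A xpredT (fun i => braket (b i) (braket v (b i) *: u)))/=.
by apply: eq_bigr => i _; rewrite !braketZr mulrC.
Qed.

Lemma trace_rank1 u v : trace b (fun x => braket v x *: u) = braket v u.
Proof. exact: (@norm_cvg_lim _ R[i]^o) (@braket_expansion u v). Qed.

End Parseval.

(** * Trace distance of pure states *)

Section PureStates.
Context {R : realType} {H : hilbertType R}.
Implicit Types (x y u v psi : H).

Lemma trace_rank2 (I : choiceType) (b : I -> H) u1 u2 v1 v2 :
  orthonormal_basis b ->
  trace b (fun x => braket v1 x *: u1 + braket v2 x *: u2) =
  braket v1 u1 + braket v2 u2.
Proof.
move=> hb; apply: (@norm_cvg_lim _ R[i]^o).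
rewrite (_ : summability.partial_sum _ = fun A =>
  summability.partial_sum (fun i => braket (b i) (braket v1 (b i) *: u1) : R[i]^o) A
  + summability.partial_sum (fun i => braket (b i) (braket v2 (b i) *: u2) : R[i]^o) A).
  by apply: cvgD; exact: braket_expansion.
apply/funext => A; rewrite /summability.partial_sum -big_split /=.
by apply: eq_bigr => i _; rewrite braketDr.
Qed.

Section Difference.
Variables psi phi : H.
Hypotheses (psi1 : `|psi| = 1) (phi1 : `|phi| = 1).
Variable T : H -> H.
Hypothesis defT : T = ketbra psi \- ketbra phi.
Let g := braket phi psi.
(** On the span of [psi] and [phi], which contains the range of [T], the operator [T^2] is
    multiplication by [c]. The only possible nonzero eigenvalues of [T] are therefore plus and minus
    the root of [c]. *)
Let c := 1 - `|g| ^+ 2.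

Let psi_psi : braket psi psi = 1. Proof. by rewrite braketxx psi1 expr1n. Qed.
Let phi_phi : braket phi phi = 1. Proof. by rewrite braketxx phi1 expr1n. Qed.
Let psi_phi : braket psi phi = g^*. Proof. by rewrite conj_braket. Qed.

Let c_ge0 : 0 <= c.
Proof.
rewrite subr_ge0 exprn_ile1//; have := CauchySchwarz phi psi.
by rewrite psi1 phi1 mulr1.
Qed.

Let boundT : bounded_op T.
Proof. by rewrite defT; apply: bounded_opB; exact: bounded_ketbra. Qed.

Let TE x : T x = braket psi x *: psi - braket phi x *: phi.
Proof. by rewrite defT. Qed.

Let T_sym x y : braket (T x) y = braket x (T y).
Proof. by rewrite defT braketBl !ketbra_sym braketBr. Qed.

Let T_psi : T psi = psi - g *: phi.
Proof. by rewrite TE psi_psi scale1r. Qed.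

Let T_phi : T phi = g^* *: psi - phi.
Proof. by rewrite TE phi_phi scale1r psi_phi. Qed.

Let TT_psi : T (T psi) = c *: psi.
Proof.
rewrite T_psi (linear_opB boundT.1) (linear_opZ boundT.1) T_psi T_phi.
by rewrite scalerBr scalerA -normCK scalerBl scale1r opprB addrA subrK.
Qed.

Let TT_phi : T (T phi) = c *: phi.
Proof.
rewrite T_phi (linear_opB boundT.1) (linear_opZ boundT.1) T_psi T_phi.
rewrite scalerBr scalerA [g^* * g]mulrC -normCK scalerBl scale1r opprB.
by rewrite addrC addrA subrK.
Qed.

Let TTT x : T (T (T x)) = c *: T x.
Proof.
rewrite [T x in LHS]TE.
rewrite (linear_opB boundT.1) !(linear_opZ boundT.1).
rewrite (linear_opB boundT.1) !(linear_opZ boundT.1) TT_psi TT_phi.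
by rewrite TE scalerBr !scalerA ![c * _]mulrC.
Qed.

(** The candidate is positive because [T] is symmetric, and its square is [T^4 / c = T^2] by
    [TTT]. *)
Let abs_op_ketbraB : abs_op T = fun x => (sqrtC c)^-1 *: T (T x).
Proof.
pose S0 x := (sqrtC c)^-1 *: T (T x); rewrite -/S0.
have boundS0 : bounded_op S0 by exact: bounded_op_scale_comp.
have posS0 : positive_op S0.
  move=> x; rewrite braketZr -T_sym mulr_ge0// ?braketxx_ge0//.
  by rewrite invr_ge0 sqrtC_ge0.
have sqS0 x : S0 (S0 x) = T (T x).
  rewrite /S0 /= !(linear_opZ boundT.1) TTT scalerA -invfM -expr2 sqrtCK.
  (* If [c = 0], the inverse is [0] by convention and [S0 = 0]. Then [T^3 = 0], and symmetry of [T]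
     gives [T^2 = 0] too. *)
  rewrite scalerA; have [c0|c_neq0] := eqVneq c 0.
    rewrite c0 mulr0 scale0r; apply/esym/braketxx_eq0.
    by rewrite T_sym TTT c0 scale0r braket0r.
  by rewrite mulVf// scale1r.
apply: xget_unique => [|S [boundS posS]].
  by split=> //; rewrite adjoint_op_sym//; apply/funext => x /=.
rewrite adjoint_op_sym// => SS.
have {}SS x : S (S x) = T (T x) by have := congr1 (@^~ x) SS.
(* Any root [S] commutes with [S^2 = T^2], hence with its multiple [S0]. *)
apply: positive_sqrt_unique => //; [exact: boundS.1|exact: boundS0.1| |].
- by move=> x; rewrite /S0 /= (linear_opZ boundS.1) -!SS.
- by move=> x; rewrite SS sqS0.
Qed.

Lemma trace_norm_diff (I : choiceType) (b : I -> H) :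
  orthonormal_basis b -> (trace_norm b T)%:C%C = 2 * sqrtC c.
Proof.
move=> hb; rewrite /trace_norm abs_op_ketbraB.
rewrite (_ : trace _ _ = 2 * sqrtC c).
  by apply: RRe_real; rewrite ger0_real// mulr_ge0// sqrtC_ge0.
(* Here [T^2 x = <psi|x> T psi - <phi|x> T phi], and both [<psi|T psi>] and [- <phi|T phi>] equal
   [c], so the trace is [2 c] over the root of [c]. *)
rewrite (_ : (fun x => _) = fun x =>
  braket psi x *: ((sqrtC c)^-1 *: (psi - g *: phi)) +
  braket phi x *: ((sqrtC c)^-1 *: (phi - g^* *: psi))).
  rewrite trace_rank2// !braketZr !braketBr !braketZr psi_psi phi_phi psi_phi -/g.
  rewrite -normCK [g^* * g]mulrC -normCK -/c.
  suff -> : (sqrtC c)^-1 * c = sqrtC c by rewrite -mulr2n mulr_natl.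
  have [->|c_neq0] := eqVneq c 0; first by rewrite mulr0 sqrtC0.
  by rewrite -{2}(sqrtCK c) expr2 mulKf// sqrtC_eq0.
apply/funext => x; rewrite (TE x).
rewrite (linear_opB boundT.1).
rewrite !(linear_opZ boundT.1) T_psi T_phi -[- (braket phi x *: _)]scalerN opprB scalerDr.
by congr (_ + _); rewrite !scalerA mulrC.
Qed.

End Difference.

Lemma trace_norm_ketbraB (I : choiceType) (b : I -> H) psi phi :
  `|psi| = 1 -> `|phi| = 1 -> orthonormal_basis b ->
  (trace_norm b (ketbra psi \- ketbra phi))%:C%C
    = 2 * sqrtC (1 - `|braket phi psi| ^+ 2).
Proof. by move=> *; apply: trace_norm_diff. Qed.

Lemma trace_norm_ge0 (I : choiceType) (b : I -> H) psi phi :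
  orthonormal_basis b -> `|psi| = 1 -> `|phi| = 1 ->
  0 <= trace_norm b (ketbra psi \- ketbra phi).
Proof.
move=> hb psi1 phi1; rewrite -ler0c trace_norm_ketbraB// mulr_ge0// sqrtC_ge0.
rewrite subr_ge0 exprn_ile1//; have := CauchySchwarz phi psi.
by rewrite psi1 phi1 mulr1.
Qed.

Lemma trace_norm_sqr (I : choiceType) (b : I -> H) psi phi :
  orthonormal_basis b -> `|psi| = 1 -> `|phi| = 1 ->
  ((trace_norm b (ketbra psi \- ketbra phi)) ^+ 2)%:C%C
    = 4 * (1 - `|braket phi psi| ^+ 2).
Proof.
move=> hb psi1 phi1; rewrite rmorphXn/= trace_norm_ketbraB// exprMn sqrtCK.
by congr (_ * _); rewrite -natrX.
Qed.

End PureStates.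

(** * Tensor powers *)

Section TensorPowers.
Context {R : realType} {H : hilbertType R} {n : nat} (K : tensor_power H n).
Implicit Types (psi : H) (x y : 'I_n -> H).

Lemma norm_tens x : `|tens K x| = \prod_(k < n) `|x k|.
Proof.
apply/eqP; rewrite -(@eqrXn2 _ 2) ?prodr_ge0// -braketxx tens_braket -prodrXl.
by apply/eqP/eq_bigr => k _; rewrite braketxx.
Qed.

(** All slots are handled at once: by [tens_braket], the difference of the two sides has bracket
    zero with itself. *)
Lemma tens_scale (c : 'I_n -> R[i]) x :
  tens K (fun k => c k *: x k) = (\prod_(k < n) c k) *: tens K x.
Proof.
set p := \prod_(_ < n) _; set t := tens K _.
have ts : braket t (tens K x) = p^* * braket (tens K x) (tens K x).
  rewrite !tens_braket rmorph_prod -big_split; apply: eq_bigr => k _.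
  by rewrite braketZl.
have tt : braket t t = p * braket t (tens K x).
  by rewrite !tens_braket -big_split; apply: eq_bigr => k _; rewrite braketZr.
apply/eqP; rewrite -subr_eq0; apply/eqP/braketxx_eq0.
rewrite braketBr braketZr !braketBl !braketZl tt -(conj_braket t) ts.
by rewrite rmorphM /= conjCK conj_braket mulrCA !subrr mulr0 subr0.
Qed.

Lemma tens_dfwithB x i u v :
  tens K (dfwith x i u) - tens K (dfwith x i v) = tens K (dfwith x i (u - v)).
Proof.
by rewrite -scaleN1r [u - v]addrC -[- v]scaleN1r tens_multilinear addrC.
Qed.

Lemma tens_basis_orthonormal (b : nat -> H) : orthonormal_basis b ->
  orthonormal_basis (tens_basis K b).
Proof.
move=> [orthb totb]; split=> [j k|].
  rewrite tens_braket; under eq_bigr do rewrite orthb.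
  have [<-|/eqP jk] := eqVneq j k; first by rewrite big1// => i _; rewrite eqxx.
  have /existsP[i jki] : [exists i, j i != k i].
    apply: contra_notT jk; rewrite negb_exists => /forallP jk.
    by apply/ffunP => i; apply/eqP; have := jk i; rewrite negbK.
  by rewrite (bigD1 i)//= (negbTE jki) mul0r.
apply: total_setP; set V := closure _.
(* Basis vectors are replaced by arbitrary ones slot by slot: the first [m] slots are free, the
   others hold basis vectors. At [m = n] no constraint remains. *)
suff tensV m : (m <= n)%N -> forall x,
    (forall k : 'I_n, (m <= k)%N -> range b (x k)) -> V (tens K x).
  apply: (total_set_ind (tens_total K)) => [|a x y|x|_ [x _ <-]].
  - exact/subset_closure/lin_span0.
  - exact: closure_lin_span_linear.
  - exact: closed_closure.
  - by apply: (tensV n) => // k; rewrite leqNgt ltn_ord.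
elim: m => [_ x bx|m IHm mn x bx].
  have /choice[j bj] : forall k, exists i, b i = x k.
    by move=> k; have [i _ <-] := bx k isT; exists i.
  apply/subset_closure/lin_span_self; exists [ffun k => j k] => //.
  by congr (tens K); apply/funext => k; rewrite ffunE bj.
have [i im] : exists i : 'I_n, i = m :> nat by exists (Ordinal mn).
(* The vectors [u] admissible in slot [m] form a closed subspace, because filling that slot
   multiplies norms by the constant [C] below. The induction hypothesis puts the basis vectors in
   it. *)
suff Vi u : V (tens K (dfwith x i u)).
  rewrite (_ : x = dfwith x i (x i))//; apply/funext => k.
  by have [<-|ik] := eqVneq i k; rewrite ?dfwithin ?dfwithout.
move: u; apply: (total_set_ind totb) => [|a u v Vu Vv|u Vu|_ [j _ <-]].
- rewrite (_ : tens K _ = 0); first exact/subset_closure/lin_span0.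
  by rewrite -(subrr (0 : H)) -tens_dfwithB subrr.
- by rewrite tens_multilinear; exact: closure_lin_span_linear.
- apply: closed_closure; apply/closure_approxP => eps eps_gt0.
  pose C := \prod_(k < n | k != i) `|x k|.
  have C1_gt0 : 0 < C + 1 by rewrite ltr_wpDl ?prodr_ge0.
  move/closure_approxP: Vu => /(_ _ (divr_gt0 eps_gt0 C1_gt0))[z Vz uz].
  exists (tens K (dfwith x i z)) => //; rewrite tens_dfwithB norm_tens (bigD1 i)//=.
  rewrite dfwithin (_ : \prod_(_ < n | _) _ = C); last first.
    by apply: eq_bigr => k ki; rewrite dfwithout// eq_sym.
  move: uz; rewrite ltr_pdivlMr//; apply: le_lt_trans.
  by rewrite ler_wpM2l// lerDl.
- apply: IHm (ltnW mn) _ _ => k mk.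
  have [<-|ik] := eqVneq i k; first by rewrite dfwithin; exists j.
  by rewrite dfwithout//; apply: bx; rewrite ltn_neqAle mk -im andbT.
Qed.

(** The right-hand side has the values required on elementary tensors by [tens_scale], and these are
    total. *)
Lemma op_tens_ketbra psi : op_tens K (ketbra psi) = ketbra (tens K (fun=> psi)).
Proof.
have ketT x :
    ketbra (tens K (fun=> psi)) (tens K x) = tens K (fun k => ketbra psi (x k)).
  by rewrite (tens_scale (fun k => braket psi (x k))) -(tens_braket K).
apply: xget_unique; first by split=> //; exact: bounded_ketbra.
move=> S [boundS Sx]; apply: (bounded_op_eq_total (tens_total K)) => //.
  exact: bounded_ketbra.
by move=> _ [x _ <-]; rewrite ketT Sx.
Qed.

(** A positive [M] is symmetric, so the product of the state and [M] is the rank-one operator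
    [z -> <M Psi|z> Psi], whose trace is known. *)
Lemma outcome_prob_ketbra (b : nat -> H) psi (M : K -> K) :
  orthonormal_basis b -> bounded_op M -> positive_op M ->
  outcome_prob b (ketbra psi) M =
    complex.Re (braket (tens K (fun=> psi)) (M (tens K (fun=> psi)))).
Proof.
move=> hb boundM posM; rewrite /outcome_prob op_tens_ketbra; congr complex.Re.
set Psi := tens K _.
rewrite (_ : _ \o M = fun z : K => braket (M Psi) z *: Psi).
  rewrite trace_rank1; last exact: tens_basis_orthonormal.
  exact: positive_op_sym boundM.1 posM _ _.
apply/funext => z /=; rewrite (positive_op_sym boundM.1 posM).
by [].
Qed.

End TensorPowers.

(** * Error probabilities *)

Section ErrorBounds.
Context {R : realType} {H : hilbertType R}.

(** A weighted Young inequality for the form of [M]: the right side minus the left is [t^-1] times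
    the form at [t x - y]. *)
Lemma positive_op_addW (M : H -> H) x y (t : R[i]) :
  linear M -> positive_op M -> 0 < t ->
  braket (x + y) (M (x + y)) <=
    (1 + t) * braket x (M x) + (1 + t^-1) * braket y (M y).
Proof.
move=> linM posM t_gt0; rewrite -subr_ge0.
rewrite [leRHS](_ : _ = t^-1 * braket (t *: x - y) (M (t *: x - y))).
  by rewrite mulr_ge0// invr_ge0 ltW.
rewrite (linear_opD linM) (linear_opB linM) (linear_opZ linM).
rewrite !(braketDl, braketDr, braketNl, braketNr, braketZl, braketZr).
rewrite (geC0_conj (ltW t_gt0)).
have t_neq0 : t != 0 by rewrite gt_eqF.
by field.
Qed.

Variable e : nat -> H.
Hypothesis he : orthonormal_basis e.

Lemma norm_tens_unit n (K : tensor_power H n) psi :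
  `|psi| = 1 -> `|tens K (fun=> psi)| = 1.
Proof. by move=> psi1; rewrite norm_tens big1. Qed.

Section Povm.
Context {n : nat} (K : tensor_power H n).
Implicit Types (M : binary_povm K) (psi : H).

Lemma povm_braketD M (x : K) :
  braket x (povm0 M x) + braket x (povm1 M x) = braket x x.
Proof.
rewrite -braketDr; congr braket; exact: (congr1 (@^~ x) (povm_complete M)).
Qed.

Lemma povm0_le M (x : K) : braket x (povm0 M x) <= braket x x.
Proof. by rewrite -(povm_braketD M) lerDl povm1_positive. Qed.

Lemma Re_le (x y : R[i]) : x <= y -> complex.Re x <= complex.Re y.
Proof. by rewrite lecE => /andP[]. Qed.

Lemma outcome_prob_ge0 psi (M : K -> K) : bounded_op M -> positive_op M ->
  0 <= outcome_prob e (ketbra psi) M.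
Proof.
by move=> bM pM; rewrite outcome_prob_ketbra//; have /Re_le := pM (tens K (fun=> psi)).
Qed.

Lemma outcome_prob_povmD M psi : `|psi| = 1 ->
  outcome_prob e (ketbra psi) (povm0 M) + outcome_prob e (ketbra psi) (povm1 M) = 1.
Proof.
move=> psi1; rewrite !outcome_prob_ketbra//; try exact: povm0_bounded;
  try exact: povm1_bounded; try exact: povm0_positive; try exact: povm1_positive.
rewrite -raddfD /= povm_braketD braketxx norm_tens_unit// expr1n//.
Qed.

Lemma outcome_prob_povm0_le1 M psi : `|psi| = 1 ->
  outcome_prob e (ketbra psi) (povm0 M) <= 1.
Proof.
move=> psi1; rewrite -(outcome_prob_povmD M psi1) lerDl outcome_prob_ge0//.
  exact: povm1_bounded.
exact: povm1_positive.
Qed.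

Section Worst.
Variables (alpha L phi : R) (psi0 : H).
Let alternatives := (hermite_sobolev e alpha L
  `&` trace_separated e (ketbra psi0) phi)%classic.

Let alternativeP rho : alternatives rho -> exists2 psi, `|psi| = 1 & rho = ketbra psi.
Proof. by case=> [[psi [-> psi1 _]] _]; exists psi. Qed.

Let outcomes_ge0 M y :
  [set outcome_prob e rho (povm0 M) | rho in alternatives]%classic y -> 0 <= y.
Proof.
move=> [rho /alternativeP[psi _ ->] <-]; apply: outcome_prob_ge0.
  exact: povm0_bounded.
exact: povm0_positive.
Qed.

Let outcomes_le1 M :
  ubound [set outcome_prob e rho (povm0 M) | rho in alternatives]%classic 1.
Proof.
move=> _ [rho /alternativeP[psi psi1 ->] <-]; exact: outcome_prob_povm0_le1.
Qed.

Lemma worst_error_ge0 M : 0 <= worst_error e alpha L (ketbra psi0) phi M.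
Proof.
rewrite addr_ge0 ?outcome_prob_ge0//; [exact: povm1_bounded|exact: povm1_positive|].
rewrite -/alternatives; set A := image _ _; have [->|/set0P[y Ay]] := eqVneq A set0.
  by rewrite sup0.
apply: le_trans (outcomes_ge0 Ay) _; apply: ub_le_sup => //.
by exists 1; exact: outcomes_le1.
Qed.

Lemma worst_error_le M c : 0 <= c ->
  (forall rho, hermite_sobolev e alpha L rho ->
     trace_separated e (ketbra psi0) phi rho ->
     outcome_prob e rho (povm0 M) <= c) ->
  worst_error e alpha L (ketbra psi0) phi M <=
    outcome_prob e (ketbra psi0) (povm1 M) + c.
Proof.
move=> c_ge0 Mc; rewrite lerD2l -/alternatives; set A := image _ _.
(* Without alternatives the supremum is [0], which [0 <= c] covers. *)
have [->|A0] := eqVneq A set0; first by rewrite sup0.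
apply: ge_sup; first exact/set0P.
by move=> _ [rho [Srho Brho] <-]; exact: Mc.
Qed.

Lemma worst_error_ge M rho : hermite_sobolev e alpha L rho ->
  trace_separated e (ketbra psi0) phi rho ->
  outcome_prob e (ketbra psi0) (povm1 M) + outcome_prob e rho (povm0 M)
    <= worst_error e alpha L (ketbra psi0) phi M.
Proof.
move=> Srho Brho; rewrite lerD2l; apply: ub_le_sup.
  by exists 1; exact: outcomes_le1.
by exists rho.
Qed.

Lemma minimax_error_le M :
  minimax_error e K alpha L (ketbra psi0) phi <=
    worst_error e alpha L (ketbra psi0) phi M.
Proof.
apply: ge_inf; last by exists M.
by exists 0 => _ [M' _ <-]; exact: worst_error_ge0.
Qed.

End Worst.
End Povm.
End ErrorBounds.

(** * Bernoulli inequalities *)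

Section Powers.
Context {R : realFieldType}.

(** The decay in [n u] of the probability of accepting an alternative. The induction uses [(1 - u)
    (1 + (n + 1) u) = 1 + n u - (n + 1) u^2]. *)
Lemma exprB1_bernoulli_le (u : R) n : 0 <= u <= 1 ->
  (1 - u) ^+ n * (1 + n%:R * u) <= 1.
Proof.
move=> /andP[u_ge0 u_le1]; elim: n => [|n IHn]; first by rewrite mul0r addr0 mulr1.
apply: le_trans IHn; rewrite exprSr -mulrA ler_wpM2l ?exprn_ge0 ?subr_ge0//.
rewrite -subr_ge0 (_ : _ - _ = n.+1%:R * u ^+ 2) ?mulr_ge0 ?exprn_ge0//.
by rewrite -natr1; ring.
Qed.

Lemma expr_bernoulli_ge (r : R) n : 0 <= r <= 1 ->
  1 - n%:R * (1 - r) <= r ^+ n.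
Proof.
move=> /andP[r_ge0 r_le1]; elim: n => [|n IHn]; first by rewrite mul0r subr0.
rewrite exprSr; apply: le_trans (ler_wpM2r r_ge0 IHn).
rewrite -subr_ge0 (_ : _ - _ = n%:R * (1 - r) ^+ 2).
  by rewrite mulr_ge0// exprn_ge0// subr_ge0.
by rewrite -natr1; ring.
Qed.

End Powers.

Lemma Re_mulrl (R : rcfType) (x : R) (z : R[i]) :
  complex.Re (x%:C%C * z) = x * complex.Re z.
Proof. by case: z => a b /=; rewrite mul0r subr0. Qed.

Lemma Re_add (R : rcfType) (y z : R[i]) :
  complex.Re (y + z) = complex.Re y + complex.Re z.
Proof. by case: y => a b; case: z. Qed.

(** Positivity of the complement is Cauchy-Schwarz. Norms below one are allowed so that [Psi = 0]
    gives the test that always rejects. *)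
Lemma rank1_povm (R : realType) (H : hilbertType R) (Psi : H) : `|Psi| <= 1 ->
  exists M : binary_povm H, povm0 M = ketbra Psi.
Proof.
move=> Psi1.
have bound1 : bounded_op (idfun : H -> H).
  by split=> //; exists 1 => x; rewrite mul1r.
have pos0 : positive_op (ketbra Psi).
  by move=> x; rewrite braketZr -(conj_braket x) mulrC -normCK exprn_ge0.
have pos1 : positive_op (idfun \- ketbra Psi).
  move=> x; rewrite /= braketBr braketZr -(conj_braket x Psi) mulrC -normCK.
  rewrite braketxx subr_ge0 ler_pXn2r ?nnegrE//.
  apply: le_trans (CauchySchwarz _ _) _.
  by rewrite -[leRHS]mulr1 ler_wpM2l.
have sum1 : ketbra Psi \+ (idfun \- ketbra Psi) = id.
  by apply/funext => x /=; rewrite addrC subrK.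
by exists (Build_binary_povm (bounded_ketbra Psi)
  (bounded_opB bound1 (bounded_ketbra Psi)) pos0 pos1 sum1).
Qed.

(** * Bounds on the minimax error at fixed sample size *)

Section Tests.
Context {R : realType} {H : hilbertType R}.
Variable e : nat -> H.
Hypothesis he : orthonormal_basis e.
Variables (n : nat) (K : tensor_power H n) (alpha L phi : R) (psi0 : H).
Hypothesis psi0_1 : `|psi0| = 1.

Lemma minimax_error_ge0 : 0 <= minimax_error e K alpha L (ketbra psi0) phi.
Proof.
apply: lb_le_inf => [|_ [M _ <-]]; last exact: worst_error_ge0.
have [|M _] := @rank1_povm R K 0; first by rewrite normr0.
by exists (worst_error e alpha L (ketbra psi0) phi M), M.
Qed.

(* The test which always rejects the null hypothesis has error exactly 1. *)
Lemma minimax_error_le1 : minimax_error e K alpha L (ketbra psi0) phi <= 1.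
Proof.
have [|M M0] := @rank1_povm R K 0; first by rewrite normr0.
apply: le_trans (minimax_error_le he alpha L phi psi0 M) _.
have M0_eq0 psi : outcome_prob e (ketbra psi) (povm0 M) = 0.
  rewrite outcome_prob_ketbra//; [|exact: povm0_bounded|exact: povm0_positive].
  by rewrite M0 /ketbra scaler0 braket0r.
rewrite -(outcome_prob_povmD he M psi0_1) M0_eq0 add0r -[leRHS]addr0.
by apply: worst_error_le => // _ [psi [-> _ _]] _; rewrite M0_eq0.
Qed.

Lemma minimax_error_le_inv : (0 < n)%N -> 0 < phi ->
  minimax_error e K alpha L (ketbra psi0) phi <= (n%:R * (phi ^+ 2 / 4))^-1.
Proof.
move=> n_gt0 phi_gt0; set Psi0 := tens K (fun=> psi0).
have Psi0_1 : `|Psi0| = 1 by exact: norm_tens_unit.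
have Psi0_sq : braket Psi0 Psi0 = 1 by rewrite braketxx Psi0_1 expr1n.
have [|M M0] := @rank1_povm R K Psi0; first by rewrite Psi0_1.
have u_gt0 : 0 < n%:R * (phi ^+ 2 / 4).
  by rewrite mulr_gt0 ?ltr0n// divr_gt0 ?exprn_gt0.
have type1 : outcome_prob e (ketbra psi0) (povm1 M) = 0.
  apply: (addrI (outcome_prob e (ketbra psi0) (povm0 M))).
  rewrite outcome_prob_povmD// addr0 outcome_prob_ketbra//;
    [|exact: povm0_bounded|exact: povm0_positive].
  by rewrite M0 /ketbra braketZr -/Psi0 Psi0_sq mulr1.
apply: le_trans (minimax_error_le he alpha L phi psi0 M) _.
rewrite -[leRHS]add0r -type1; apply: worst_error_le; first by rewrite invr_ge0 ltW.
move=> _ [psi [-> psi1 _]] [_ sep].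
(* By the trace norm formula [u = 1 - |<psi0|psi>|^2], so the acceptance probability is
   [(1 - u)^n]. *)
set t := trace_norm _ _ in sep; set u := t ^+ 2 / 4.
have g_sq : `|braket psi0 psi| ^+ 2 = (1 - u)%:C%C.
  have := trace_norm_sqr he psi1 psi0_1; rewrite -/t => t_sq.
  rewrite rmorphB rmorph1 /u rmorphM /= t_sq fmorphV rmorph_nat /=.
  by field.
have u_ge : phi ^+ 2 / 4 <= u.
  by rewrite ler_pM2r ?invr_gt0// ler_pXn2r ?nnegrE// ?ltW// (lt_le_trans phi_gt0).
have u_01 : 0 <= u <= 1.
  apply/andP; split; first by rewrite divr_ge0// sqr_ge0.
  by rewrite -subr_ge0 -ler0c -g_sq exprn_ge0.
rewrite outcome_prob_ketbra//; [|exact: povm0_bounded|exact: povm0_positive].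
rewrite M0 /ketbra braketZr -(conj_braket Psi0) -normCK tens_braket.
rewrite prodr_const card_ord normrX exprAC g_sq -rmorphXn /=.
have := exprB1_bernoulli_le n u_01.
have nu_gt0 : 0 < 1 + n%:R * u.
  by rewrite ltr_pwDl// mulr_ge0//; case/andP: u_01.
rewrite -ler_pdivlMr// div1r => /le_trans; apply.
rewrite lef_pV2 ?posrE// (le_trans (y := n%:R * u)) ?lerDr//.
by rewrite ler_wpM2l.
Qed.

(** The two errors at [psi0] and [psi] sum to [1 - <Psi0|M0 Psi0> + <Psi|M0 Psi>]. Splitting
    [Psi0 = Psi + (Psi0 - Psi)] in [positive_op_addW] bounds the loss by
    [t + (1 + t^-1) |Psi0 - Psi|^2], where [|Psi0 - Psi|^2 = 2 - 2 r^n <= 2 n (1 - r)]. *)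
Lemma minimax_error_ge psi (r t : R) : `|psi| = 1 -> braket psi0 psi = r%:C%C ->
  0 <= r <= 1 -> hermite_sobolev e alpha L (ketbra psi) ->
  trace_separated e (ketbra psi0) phi (ketbra psi) -> 0 < t ->
  1 - (t + (1 + t^-1) * (2 * n%:R * (1 - r))) <=
    minimax_error e K alpha L (ketbra psi0) phi.
Proof.
move=> psi1 psi0psi r01 Spsi Bpsi t_gt0.
apply: lb_le_inf => [|_ [M _ <-]].
  have [|M _] := @rank1_povm R K 0; first by rewrite normr0.
  by exists (worst_error e alpha L (ketbra psi0) phi M), M.
apply: le_trans (worst_error_ge he M Spsi Bpsi).
have := outcome_prob_povmD he M psi0_1.
have := outcome_prob_povm0_le1 he M psi1.
rewrite !outcome_prob_ketbra//; try exact: povm0_bounded;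
  try exact: povm1_bounded; try exact: povm0_positive; try exact: povm1_positive.
set Psi0 := tens K (fun=> psi0); set Psi := tens K (fun=> psi) => q1 q01.
have [linM0 _] := povm0_bounded M.
have tC_gt0 : 0 < t%:C%C by rewrite ltcR.
have := positive_op_addW Psi (Psi0 - Psi) linM0 (povm0_positive M) tC_gt0.
rewrite subrKC => h.
set D := 2 * n%:R * (1 - r).
have d_le : braket (Psi0 - Psi) (povm0 M (Psi0 - Psi)) <= D%:C%C.
  apply: le_trans (povm0_le M _) _.
  have ip : braket Psi0 Psi = (r ^+ n)%:C%C.
    by rewrite tens_braket prodr_const card_ord psi0psi -rmorphXn.
  have ip' : braket Psi Psi0 = (r ^+ n)%:C%C.
    by rewrite -conj_braket ip geC0_conj// ler0c exprn_ge0//; case/andP: r01.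
  rewrite !(braketBl, braketBr) ip ip' !braketxx !norm_tens_unit// expr1n.
  rewrite -(rmorph1 (real_complex R)) -!rmorphB lecR /D.
  have := expr_bernoulli_ge n r01; lra.
have tV : 0 <= 1 + t%:C%C^-1 by rewrite addr_ge0// invr_ge0 ltW.
have := Re_le (le_trans h (lerD (lexx _) (ler_wpM2l tV d_le))).
have -> : 1 + t%:C%C = (1 + t)%:C%C by rewrite rmorphD rmorph1.
have -> : (1 + t%:C%C^-1) * D%:C%C = ((1 + t^-1) * D)%:C%C.
  by rewrite (rmorphM _ (1 + t^-1)) (rmorphD _ 1) rmorph1 fmorphV.
rewrite Re_add Re_mulrl.
rewrite (_ : complex.Re ((1 + t^-1) * D)%:C%C = (1 + t^-1) * D)//.
have : t * complex.Re (braket Psi (povm0 M Psi)) <= t by rewrite ler_piMr// ltW.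
lra.
Qed.

End Tests.

(** * Alternatives close to the null hypothesis *)

Lemma nneseries_leP (R : realType) (a : nat -> R) (L : R) :
  (forall j, 0 <= a j) ->
  (\sum_(0 <= j <oo) (a j)%:E <= L%:E)%E <->
  forall N, \sum_(0 <= j < N) a j <= L.
Proof.
move=> a_ge0; split=> [aL N|aL].
  rewrite -lee_fin -sumEFin; apply: le_trans aL.
  by apply: nneseries_lim_ge => j _ _; rewrite lee_fin.
apply: lime_le; first by apply: is_cvg_nneseries => j _ _; rewrite lee_fin.
by near=> N; rewrite sumEFin lee_fin.
Unshelve. all: by end_near. Qed.

Section Alternatives.
#[local] Arguments complex.Re : simpl never.
Context {R : realType} {H : hilbertType R}.
Variable e : nat -> H.
Hypothesis he : orthonormal_basis e.
Implicit Types (psi v : H).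

Lemma normalize (w : H) : w != 0 -> `|(`|w|^-1 *: w)| = 1.
Proof.
by move=> w0; rewrite normrZ normfV normr_id mulVf// normr_eq0.
Qed.

Lemma norm_basis j : `|e j| = 1.
Proof.
by apply/eqP; rewrite -(@eqrXn2 _ 2)// -braketxx he.1 eqxx expr1n.
Qed.

(** The form [<psi|.>] has a nontrivial kernel on the plane of [e 0] and [e 1]. The case split makes
    the kernel vector [w] visibly nonzero, through its coordinate along [e 1]. *)
Lemma low_energy_orthogonal psi : exists v, [/\ `|v| = 1, braket psi v = 0
  & forall j, (1 < j)%N -> braket (e j) v = 0].
Proof.
have [psi0|psi0] := eqVneq (braket psi (e 0)) 0.
  exists (e 0); split=> [||j j1] //; first exact: norm_basis.
   rewrite he.1; case: eqP j1 => // ->//.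
pose w := braket psi (e 1) *: e 0 - braket psi (e 0) *: e 1.
have w0 : w != 0.
  apply: contra_neq psi0 => w0; have := congr1 (braket (e 1)) w0.
  rewrite braketBr !braketZr !he.1 /= braket0r mulr0 mulr1 sub0r => /eqP.
  by rewrite oppr_eq0 => /eqP.
exists (`|w|^-1 *: w); split; first exact: normalize.
  by rewrite braketZr braketBr !braketZr mulrC [X in _ - X]mulrC subrr mul0r.
move=> j j1; rewrite braketZr braketBr !braketZr !he.1.
by case: j j1 => [|[|j]]//= _; rewrite !mulr0 subrr mulr0.
Qed.

Lemma sqr_addW (a b t : R) : 0 < t ->
  (a + b) ^+ 2 <= (1 + t) * a ^+ 2 + (1 + t^-1) * b ^+ 2.
Proof.
move=> t_gt0; rewrite -subr_ge0.
rewrite [leRHS](_ : _ = t^-1 * (t * a - b) ^+ 2).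
  by rewrite mulr_ge0 ?sqr_ge0 ?invr_ge0 ?ltW.
by field; rewrite gt_eqF.
Qed.

Let Re_ge0 (z : R[i]) : 0 <= z -> 0 <= complex.Re z.
Proof. exact: (@Re_le _ 0). Qed.

Let energy alpha psi N :=
  \sum_(0 <= j < N) complex.Re `|braket (e j) psi| ^+ 2 * j%:R `^ (2 * alpha).

Let hermite_sobolevP alpha L psi : `|psi| = 1 ->
  (forall N, energy alpha psi N <= L) -> hermite_sobolev e alpha L (ketbra psi).
Proof.
move=> psi1 psiL; exists psi; split=> //; apply/nneseries_leP => //.
by move=> j; rewrite mulr_ge0 ?powR_ge0 ?sqr_ge0.
Qed.

(** Only [j = 1] contributes, with weight [1]: the weight at [j = 0] vanishes because [alpha] is
    positive. *)
Let energy_low (alpha : R) v N : 0 < alpha -> `|v| = 1 ->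
  (forall j, (1 < j)%N -> braket (e j) v = 0) -> energy alpha v N <= 1.
Proof.
move=> alpha_gt0 v1 v_low.
have zero j : j != 1%N ->
    complex.Re `|braket (e j) v| ^+ 2 * j%:R `^ (2 * alpha) = 0.
  case: j => [|[|j]]// _; first by rewrite powR0 ?mulr0// mulf_neq0// gt_eqF.
  by rewrite v_low// normr0 /= expr0n mul0r.
have one : complex.Re `|braket (e 1) v| ^+ 2 * 1%:R `^ (2 * alpha) <= 1.
  rewrite powR1 mulr1 exprn_ile1 ?Re_ge0//.
  by have := CauchySchwarz (e 1) v; rewrite v1 norm_basis mulr1 => /Re_le.
rewrite /energy big_mkord; case: (ltnP 1 N) => N1.
  rewrite (bigD1 (Ordinal N1))//= big1 ?addr0// => j j1.
  by rewrite zero//; apply: contra_neq j1 => j1; apply: val_inj.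
rewrite big1// => j _; rewrite zero// ltn_eqF//.
exact: leq_trans (ltn_ord j) N1.
Qed.

(** Coordinatewise [sqr_addW]. The factor [1 + t] can be brought as close to [1] as the slack
    [L - L'] demands, at the price of a smaller [s]. *)
Let energy_le_addW alpha psi v (c s t : R) N : 0 <= c <= 1 -> 0 <= s -> 0 < t ->
  energy alpha (c%:C%C *: psi + s%:C%C *: v) N <=
    (1 + t) * energy alpha psi N + (1 + t^-1) * s ^+ 2 * energy alpha v N.
Proof.
move=> /andP[c_ge0 c_le1] s_ge0 t_gt0; rewrite /energy !mulr_sumr -big_split /=.
apply: ler_sum => j _; set w := j%:R `^ _.
have norm_real (r : R) : 0 <= r -> `|r%:C%C| = r%:C%C.
  by move=> ?; rewrite ger0_norm// ler0c.
rewrite braketDr !braketZr.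
have a_ge0 := Re_ge0 (normr_ge0 (braket (e j) psi)).
have b_ge0 := Re_ge0 (normr_ge0 (braket (e j) v)).
have ab_ge0 := Re_ge0 (normr_ge0
  (c%:C%C * braket (e j) psi + s%:C%C * braket (e j) v)).
have := Re_le (ler_normD (c%:C%C * braket (e j) psi) (s%:C%C * braket (e j) v)).
rewrite !normrM !norm_real// Re_add !Re_mulrl.
move: a_ge0 b_ge0 ab_ge0; set a := complex.Re `|braket (e j) psi|.
set b := complex.Re `|braket (e j) v|; set ab := complex.Re `|_ + _|.
move: a b ab => a b ab a_ge0 b_ge0 ab_ge0 ab_le.
rewrite [leRHS](_ : _ = ((1 + t) * a ^+ 2 + (1 + t^-1) * (s * b) ^+ 2) * w).
  rewrite ler_wpM2r ?powR_ge0//; apply: (@le_trans _ _ ((c * a + s * b) ^+ 2)).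
    by rewrite ler_pXn2r ?nnegrE ?addr_ge0 ?mulr_ge0.
  apply: (le_trans (sqr_addW (c * a) (s * b) t_gt0)); rewrite lerD2r.
  rewrite ler_wpM2l ?addr_ge0 ?(ltW t_gt0)// exprMn.
  by rewrite ler_piMl ?sqr_ge0// exprn_ile1.
by ring.
Qed.

Lemma close_alternative (alpha L' L : R) (psi0 : H) : 0 < alpha -> L' < L ->
  `|psi0| = 1 ->
  (\sum_(0 <= j <oo) (complex.Re `|braket (e j) psi0| ^+ 2
     * j%:R `^ (2 * alpha))%:E <= L'%:E)%E ->
  exists2 phi0 : R, 0 < phi0 & forall phi, 0 < phi <= phi0 ->
    exists psi, [/\ `|psi| = 1,
      braket psi0 psi = (Num.sqrt (1 - phi ^+ 2 / 4))%:C%C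
      & hermite_sobolev e alpha L (ketbra psi)].
Proof.
move=> alpha_gt0 L'L psi0_1 /nneseries_leP psi0L'.
have {}psi0L' N : energy alpha psi0 N <= L'.
  by apply: psi0L' => j; rewrite mulr_ge0 ?powR_ge0 ?sqr_ge0.
have L'_ge0 : 0 <= L' by have := psi0L' 0; rewrite /energy big_nil.
have [v [v1 psi0v v_low]] := low_energy_orthogonal psi0.
(* The slack is shared equally: this [t] gives [t L' <= (L - L') / 2], and [s <= s0] with [s <= 1]
   gives [k s^2 <= (L - L') / 2]. The [+ 1] covers [L' = 0]. *)
pose t := (L - L') / (2 * (L' + 1)).
have t_gt0 : 0 < t by rewrite divr_gt0 ?subr_gt0// mulr_gt0// ltr_wpDl.
pose k := 1 + t^-1; have k_gt0 : 0 < k by rewrite addr_gt0 ?invr_gt0.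
pose s0 := (L - L') / 2 / k.
have s0_gt0 : 0 < s0 by rewrite !divr_gt0 ?subr_gt0.
exists (2 * Num.min 1 s0) => [|phi /andP[phi_gt0]].
  by rewrite mulr_gt0// lt_min ltr01 s0_gt0.
pose s := phi / 2; have s_gt0 : 0 < s by rewrite divr_gt0.
rewrite mulrC -ler_pdivrMr// -/s le_min => /andP[s_le1 s_le].
have s2_le1 : s ^+ 2 <= 1 by rewrite exprn_ile1// ltW.
have -> : phi ^+ 2 / 4 = s ^+ 2 by rewrite /s expr_div_n -natrX.
set c := Num.sqrt (1 - s ^+ 2).
have c2 : c ^+ 2 = 1 - s ^+ 2 by rewrite sqr_sqrtr// subr_ge0.
have c_ge0 : 0 <= c by exact: sqrtr_ge0.
have c_le1 : c <= 1 by rewrite -(@expr_le1 _ 2)// c2 gerBl sqr_ge0.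
pose psi := c%:C%C *: psi0 + s%:C%C *: v.
have vpsi0 : braket v psi0 = 0 by rewrite -conj_braket psi0v rmorph0.
have psi0psi0 : braket psi0 psi0 = 1 by rewrite braketxx psi0_1 expr1n.
have vv : braket v v = 1 by rewrite braketxx v1 expr1n.
have psi1 : `|psi| = 1.
  apply/eqP; rewrite -(@eqrXn2 _ 2)// expr1n -braketxx.
  rewrite !(braketDl, braketDr, braketZl, braketZr) psi0psi0 vv psi0v vpsi0.
  rewrite !mulr0 !mulr1 addr0 add0r !geC0_conj ?ler0c ?(ltW s_gt0)//.
  by rewrite -!rmorphM -rmorphD -!expr2 c2 subrK.
exists psi; split=> //.
  by rewrite braketDr !braketZr psi0psi0 psi0v mulr1 mulr0 addr0.
apply: hermite_sobolevP => // N.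
have c01 : 0 <= c <= 1 by rewrite c_ge0.
apply: le_trans (energy_le_addW alpha psi0 v N c01 (ltW s_gt0) t_gt0) _.
have e1 : (1 + t) * energy alpha psi0 N <= (1 + t) * L'.
  by rewrite ler_wpM2l// addr_ge0// ltW.
have tL' : t * L' <= (L - L') / 2.
  rewrite /t invfM mulrA -mulrA ler_piMr// ?divr_ge0 ?subr_ge0 ?(ltW L'L)//.
  by rewrite mulrC ler_pdivrMr ?mul1r ?ltr_wpDl// lerDl.
have ks : k * s ^+ 2 * energy alpha v N <= (L - L') / 2.
  have [v_ge0 v_le1] : 0 <= energy alpha v N /\ energy alpha v N <= 1.
    split; last exact: energy_low.
    by apply: sumr_ge0 => j _; rewrite mulr_ge0 ?powR_ge0 ?sqr_ge0.
  apply: (@le_trans _ _ (k * s ^+ 2)).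
    by rewrite ler_piMr// mulr_ge0 ?sqr_ge0// ltW.
  rewrite mulrC -ler_pdivlMr// -/s0; apply: le_trans s_le.
  by rewrite expr2 ler_piMl// ltW.
rewrite -/k; lra.
Qed.

(** This overlap makes the trace distance exactly [phi], so the alternative sits on the boundary of
    the separation condition. *)
Lemma trace_separated_ketbra (psi0 psi : H) (phi : R) : `|psi0| = 1 -> `|psi| = 1 ->
  0 <= phi -> phi ^+ 2 / 4 <= 1 ->
  braket psi0 psi = (Num.sqrt (1 - phi ^+ 2 / 4))%:C%C ->
  trace_separated e (ketbra psi0) phi (ketbra psi).
Proof.
move=> psi0_1 psi1 phi_ge0 phi_le psi0psi; split; first by exists psi.
rewrite -(@ler_pXn2r _ 2) ?nnegrE ?trace_norm_ge0// -lecR trace_norm_sqr//.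
rewrite psi0psi ger0_norm ?ler0c ?sqrtr_ge0// -rmorphXn /= sqr_sqrtr ?subr_ge0//.
by rewrite -(rmorph1 (real_complex R)) -rmorphB -(rmorph_nat (real_complex R))
  -rmorphM lecR subKr mulrC divfK.
Qed.

End Alternatives.

(** * Rates *)

(** Both error bounds are controlled by [n phi_n^2], the square of the ratio of [phi_n] to the
    rate. *)
Lemma rate_ratio_sqr (R : realType) (x : R) n :
  (x / n%:R `^ (- 2^-1)) ^+ 2 = n%:R * x ^+ 2.
Proof.
by rewrite powRN powR12_sqrt// invrK exprMn sqr_sqrtr// mulrC.
Qed.

Section Rates.
Context {R : realType} {H : hilbertType R} (e : nat -> H).
Hypothesis he : orthonormal_basis e.
Variable HT : forall n : nat, tensor_power H n.
Variables (alpha L : R) (psi0 : H) (phi : nat -> R).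
Hypothesis psi0_1 : `|psi0| = 1.
Hypothesis phi_gt0 : forall n, (0 < n)%N -> 0 < phi n.
Let ratio n := phi n / n%:R `^ (- 2^-1).
Let Pe n := minimax_error e (HT n) alpha L (ketbra psi0) (phi n).

Let ratio_gt0 n : (0 < n)%N -> 0 < ratio n.
Proof.
move=> n_gt0; apply: divr_gt0; first exact: phi_gt0.
by apply: powR_gt0; rewrite ltr0n.
Qed.

Lemma minimax_error_cvg0 : ratio @ \oo --> +oo -> Pe @ \oo --> (0 : R).
Proof.
move=> /cvgryPge ratio_oo; apply/cvgrPdist_le => eps eps_gt0.
(* The bound needed is [4 / eps] on the squared ratio; the summand [1] lets the square dominate
   [4 / eps] whatever its size. *)
apply: filterS2 (ratio_oo (1 + 4 / eps)) (nbhs_infty_gt 0) => n ratio_ge n_gt0.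
rewrite sub0r normrN ger0_norm ?minimax_error_ge0//.
apply: le_trans (minimax_error_le_inv he (HT n) alpha L psi0_1 n_gt0 (phi_gt0 n_gt0)) _.
rewrite mulrA -rate_ratio_sqr -/(ratio n) invf_div.
rewrite ler_pdivrMr ?exprn_gt0 ?ratio_gt0// mulrC -ler_pdivrMr//.
have eps4 : 0 < 4 / eps by rewrite divr_gt0.
nra.
Qed.

Lemma minimax_error_cvg1 L' : 0 < alpha -> L' < L ->
  (\sum_(0 <= j <oo) (complex.Re `|braket (e j) psi0| ^+ 2
     * j%:R `^ (2 * alpha))%:E <= L'%:E)%E ->
  ratio @ \oo --> (0 : R) -> Pe @ \oo --> (1 : R).
Proof.
move=> alpha_gt0 L'L psi0L' /cvgrPdist_lt ratio0; apply/cvgrPdist_le => eps eps_gt0.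
have [phi0 phi0_gt0 alt] := close_alternative he alpha_gt0 L'L psi0_1 psi0L'.
pose k := 1 + (eps / 2)^-1; have k_gt0 : 0 < k by rewrite addr_gt0 ?invr_gt0 ?divr_gt0.
(* The threshold [1] gives [s^2 <= s], [phi0] makes an alternative available, and [eps / k] gives
   [k s <= eps]. The loss [eps / 2 + k s^2 / 2] is then at most [eps]. *)
have d_gt0 : 0 < Num.min (Num.min 1 phi0) (eps / k) by 
  rewrite !lt_min ltr01 phi0_gt0 divr_gt0.
apply: filterS2 (ratio0 _ d_gt0) (nbhs_infty_gt 0) => n ratio_lt n_gt0.
have r_gt0 := ratio_gt0 n_gt0; have r_sq := rate_ratio_sqr (phi n) n.
rewrite -/(ratio n) in r_sq; move: (ratio n) r_gt0 r_sq ratio_lt => s s_gt0 s_sq.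
rewrite sub0r normrN gtr0_norm// !lt_min => /andP[/andP[s_lt1 s_lt0] s_lt].
have p_gt0 := phi_gt0 n_gt0; set p := phi n in p_gt0 s_sq *.
have p_le : p <= s.
  rewrite -(@ler_pXn2r _ 2) ?nnegrE ?(ltW p_gt0) ?(ltW s_gt0)// s_sq ler_peMl ?sqr_ge0//.
  by rewrite ler1n.
have [|psi [psi1 psi0psi Spsi]] := alt p.
  by rewrite p_gt0 (le_trans p_le)// ltW.
have p2_le1 : p ^+ 2 / 4 <= 1 by nra.
set r := Num.sqrt _ in psi0psi.
have r_ge0 : 0 <= r by exact: sqrtr_ge0.
have r_sq : r ^+ 2 = 1 - p ^+ 2 / 4 by rewrite sqr_sqrtr ?subr_ge0.
have r_le1 : r <= 1 by nra.
(* Since [0 <= r <= 1], [1 - r <= 1 - r^2]. *)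
have r_ge : 1 - r <= p ^+ 2 / 4 by nra.
have Bpsi := trace_separated_ketbra he psi0_1 psi1 (ltW p_gt0) p2_le1 psi0psi.
have r01 : 0 <= r <= 1 by rewrite r_ge0.
have eps2 : 0 < eps / 2 by rewrite divr_gt0.
have := minimax_error_ge he (HT n) psi0_1 psi1 psi0psi r01 Spsi Bpsi eps2.
have := minimax_error_le1 he (HT n) alpha L p psi0_1.
rewrite -/(Pe n) -/k => Pe_le1 Pe_ge.
rewrite ger0_norm ?subr_ge0// lerBlDr -lerBlDl (le_trans _ Pe_ge)//.
have n1r : n%:R * (1 - r) <= s ^+ 2 / 4.
  by rewrite s_sq -mulrA ler_wpM2l.
have ks : k * s <= eps by rewrite mulrC -ler_pdivlMr// ltW.
have ks2 : k * s ^+ 2 <= eps by nra.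
have : k * (2 * n%:R * (1 - r)) <= k * (s ^+ 2 / 2).
  by rewrite ler_wpM2l ?(ltW k_gt0)//; lra.
lra.
Qed.

End Rates.

Theorem theorem5p6 (R : realType) (H : hilbertType R) (e : nat -> H)
    (he : orthonormal_basis e) (HT : forall n : nat, tensor_power H n)
    (alpha L : R) (alpha_gt0 : 0 < alpha) (L_gt0 : 0 < L) (rho0 : H -> H)
    (hrho0 : exists2 L' : R, L' < L & hermite_sobolev e alpha L' rho0) :
  minimax_separation_rate
    (fun n : nat => minimax_error e (HT n) alpha L rho0)
    (fun n : nat => n%:R `^ (- 2^-1)).
Proof.
move=> phi phi_gt0 _; have [L' L'L [psi0 [-> psi0_1 psi0L']]] := hrho0; split.
- exact: (minimax_error_cvg1 he HT psi0_1 phi_gt0 alpha_gt0 L'L psi0L').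
- exact: (minimax_error_cvg0 he HT alpha L psi0_1 phi_gt0).
Qed.
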